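(* Let $n\geq 2$ and let $\boldsymbol{X}=(X_1,\ldots,X_n)^\top$ be an absolutely continuous random vector (i.e. with a joint probability density function; the components are not necessarily independent) such that all expected values involved exist (are finite) and $R_{i,j}>0$ for all $i\neq j$. Then $$GMD_n=\frac{1}{\binom{n}{2}}\sum_{1\leq i<j\leq n}\left(2R_{j,i}\,\mu_{H_{j,i}}+2R_{i,j}\,\mu_{H_{i,j}}-\mu_i-\mu_j\right),$$ where $\mu_i=\mathbb{E}(X_i)$ and $\mu_{H_{i,j}}=\int_{-\infty}^{\infty}x\,h_{i,j}(x)\,dx$ is the expected value with respect to the distribution $H_{i,j}$.
   Context: The Gini mean difference is $GMD_n=\frac{1}{\binom{n}{2}}\sum_{1\leq i<j\leq n}\mathbb{E}(|X_i-X_j|)$. For $i\neq j$, $f_{X_j}$ is the marginal probability density of $X_j$; $\pi_{i,j}(x)=F_{X_i\mid(X_j=x)}(x)$ is the conditional cumulative distribution function of $X_i$ given $X_j=y$, evaluated at $y=x$, i.e. $\pi_{i,j}(x)=\mathbb{P}(X_i\leq x\mid X_j=x)=\frac{1}{f_{X_j}(x)}\int_{-\infty}^x f_{X_i,X_j}(u,x)\,du$ where $f_{X_j}(x)>0$ (values in $[0,1]$ elsewhere are immaterial); $R_{i,j}=\mathbb{P}(X_i\leq X_j)=\mathbb{E}[\pi_{i,j}(X_j)]$. The probability density $h_{i,j}$ is $h_{i,j}(x)=f_{X_j}(x)\,\pi_{i,j}(x)/R_{i,j}$, and $H_{i,j}$ is the cumulative distribution function with density $h_{i,j}$. *)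

(* Defs.v *)
From HB Require Import structures.
From mathcomp Require Import all_boot all_order all_algebra.
From mathcomp Require Import all_classical all_reals all_analysis.

Set Implicit Arguments.
Unset Strict Implicit.
Unset Printing Implicit Defensive.

Import Order.TTheory GRing.Theory Num.Theory.
Import numFieldNormedType.Exports.

Local Open Scope classical_set_scope.
Local Open Scope ring_scope.
Local Open Scope ereal_scope.

Section lebesgue_tuple.
Context (R : realType).

Definition tuple_cons (n : nat) (p : n.-tuple (measurableTypeR R) * measurableTypeR R) :
  n.+1.-tuple (measurableTypeR R) := [the n.+1.-tuple _ of p.2 :: p.1].

Lemma measurable_tuple_cons n : measurable_fun [set: _] (@tuple_cons n).
Proof.
apply: (@measurable_cons _ _ _ _ snd n fst);
  [exact: measurable_snd|exact: measurable_fst].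
Qed.

Section add_coordinate.
Context (n : nat) (mu : {measure set (n.-tuple (measurableTypeR R)) -> \bar R}).

Definition add_coordinate : set (n.+1.-tuple (measurableTypeR R)) -> \bar R :=
  pushforward (mu \x @lebesgue_measure R) (@tuple_cons n).

Let add_coordinate0 : add_coordinate set0 = 0.
Proof. by rewrite /add_coordinate /pushforward preimage_set0 measure0. Qed.

Let add_coordinate_ge0 A : 0 <= add_coordinate A.
Proof. by rewrite /add_coordinate /pushforward measure_ge0. Qed.

Let add_coordinate_sigma_additive : semi_sigma_additive add_coordinate.
Proof.
exact: (@measure_semi_sigma_additive _ _ _
  (measure_function_pushforward__canonical__measure_function_Measure
    (mu \x @lebesgue_measure R) (@measurable_tuple_cons n))).
Qed.

HB.instance Definition _ := isMeasure.Build _ _ _ add_coordinate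
  add_coordinate0 add_coordinate_ge0 add_coordinate_sigma_additive.

End add_coordinate.

(* Lebesgue measure on R^n, starting from the unit mass on the only point of
   R^0. *)
Fixpoint lebesgue_tuple (n : nat) :
    {measure set (n.-tuple (measurableTypeR R)) -> \bar R} :=
  match n with
  | 0 => \d_([tuple] : 0.-tuple (measurableTypeR R))
  | n'.+1 => add_coordinate (lebesgue_tuple n')
  end.

End lebesgue_tuple.

Section gini.
Context (d : measure_display) (Omega : measurableType d) (R : realType)
  (P : probability Omega R).

(* A density is determined only almost everywhere: any everywhere nonnegative
   representative is allowed. *)
Definition has_density (d' : measure_display) (T : measurableType d')
    (mu : set T -> \bar R) (Y : Omega -> T) (f : T -> R) : Prop :=
  [/\ measurable_fun [set: T] f,
      (forall t, (0 <= f t)%R) &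
      forall A : set T, measurable A ->
        pushforward P Y A = \int[mu]_(t in A) (f t)%:E].

Definition has_joint_density (n : nat) (X : 'I_n -> {RV P >-> R})
    (f : n.-tuple (measurableTypeR R) -> R) : Prop :=
  has_density (@lebesgue_tuple R n) (fun w => [tuple X i w | i < n]) f.

Definition has_pair_density (Y Z : {RV P >-> R})
    (f : measurableTypeR R * measurableTypeR R -> R) : Prop :=
  has_density (@lebesgue_measure R \x @lebesgue_measure R)
    (fun w => (Y w, Z w)) f.

Definition has_marginal_density (Y : {RV P >-> R}) (f : measurableTypeR R -> R)
    : Prop :=
  has_density (@lebesgue_measure R) Y f.

(* P(Y <= y | Z = z) for z with fZ z > 0, where fYZ is a density of (Y, Z) and
   fZ a density of Z. *)
Definition cond_cdf (fYZ : R * R -> R) (fZ : R -> R) (y z : R) : R :=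
  ((\int[@lebesgue_measure R]_(u in `]-oo, y]) fYZ (u, z))%R / fZ z)%R.

(* p(x) = P(Y <= x | Z = x) where fZ x > 0; where fZ vanishes, p x may be any
   number in [0, 1]. *)
Definition is_diag_cond_cdf (fYZ : R * R -> R) (fZ : R -> R) (p : R -> R)
    : Prop :=
  forall x, if (0 < fZ x)%R then p x = cond_cdf fYZ fZ x x
            else (0 <= p x <= 1)%R.

Definition prob_le (Y Z : Omega -> R) : \bar R := P [set w | (Y w <= Z w)%R].

(* The density f_Z(x) P(Y <= x | Z = x) / P(Y <= Z), with p = P(Y <= x | Z = x)
   and r = P(Y <= Z). *)
Definition hdens (fZ p : R -> R) (r : R) (x : R) : R := (fZ x * p x / r)%R.

Definition density_mean (h : R -> R) : \bar R :=
  \int[@lebesgue_measure R]_x (x * h x)%:E.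

Definition gini_mean_difference (n : nat) (X : 'I_n -> {RV P >-> R}) : \bar R :=
  ('C(n, 2)%:R^-1)%:E *
  \sum_(i < n) \sum_(j < n | (i < j)%N) 'E_P[fun w => `|X i w - X j w|%R].

End gini.

(* Main.v *)
Require Import Defs.
From HB Require Import structures.
From mathcomp Require Import all_boot all_order all_algebra.
From mathcomp Require Import all_classical all_reals all_analysis.
From mathcomp Require Import measurable_realfun lra.
Import Order.TTheory GRing.Theory Num.Theory.
Import numFieldNormedType.Exports.
Local Open Scope classical_set_scope.
Local Open Scope ring_scope.
Local Open Scope ereal_scope.

(** Pointwise, off the event Y = Z,
      |Y - Z| = 2 Y 1{Z <= Y} + 2 Z 1{Y <= Z} - Y - Z,
    since the larger of the two values is counted by exactly one indicator.  A
    pair with a joint density has P(Y = Z) = 0, because the diagonal of the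
    plane is Lebesgue-null ([prob_eq_pair_density]).  Taking expectations
    ([expectation_dist]) reduces the formula, one pair of indices at a time, to
      P(Y <= Z) * (mean of the density h) = E[Z 1{Y <= Z}],
    which is [density_mean_hdens].

    For that identity, write f for the density of (Y, Z).  The probability
    P(Y <= Z) cancels the normalisation of h, so the left-hand side is the
    integral of z * (fZ z * p z).  The density fZ is almost everywhere the
    z-section integral of f ([ae_marginal_density]); hence fZ z * p z is almost
    everywhere the integral of f(u, z) over u <= z ([ae_mul_diag_cond_cdf]),
    also where fZ z = 0 and the value of p is arbitrary.  Fubini turns the
    left-hand side into the double integral of z 1{u <= z} f(u, z), and
    integrating against a density computes the expectation of Z 1{Y <= Z}
    ([integral_has_density]). *)

(** * Measurable sets and product measures *)

Lemma measurable_set_le {d : measure_display} {T : measurableType d}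
  {R : realType} (f g : T -> R) :
  measurable_fun [set: T] f -> measurable_fun [set: T] g ->
  measurable [set x | (f x <= g x)%R].
Proof.
move=> mf mg; have mb := measurable_fun_ler mf mg.
by have := @mb measurableT [set true] I; rewrite setTI.
Qed.

Lemma measurable_set_eq {d : measure_display} {T : measurableType d}
  {R : realType} (f g : T -> R) :
  measurable_fun [set: T] f -> measurable_fun [set: T] g ->
  measurable [set x | f x = g x].
Proof.
move=> mf mg.
have -> : [set x | f x = g x] =
    [set x | (f x <= g x)%R] `&` [set x | (g x <= f x)%R].
  apply/seteqP; split => [x /= ->|x [/= fg gf]]; first by rewrite lexx.
  by apply/eqP; rewrite eq_le fg gf.
by apply: measurableI; exact: measurable_set_le.
Qed.

Section product_sigma_finite.
Context {d1 d2 : measure_display} {T1 : measurableType d1}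
  {T2 : measurableType d2} {R : realType}
  (m1 : {sigma_finite_measure set T1 -> \bar R})
  (m2 : {sigma_finite_measure set T2 -> \bar R}).

Lemma sigma_finite_product : sigma_finite setT (m1 \x m2).
Proof.
have /sigma_finiteP[A [AT ndA mA]] := sigma_finiteT m1.
have /sigma_finiteP[B [BT ndB mB]] := sigma_finiteT m2.
exists (fun n => A n `*` B n) => [|n].
  apply/seteqP; split => // -[x y] _.
  have [i _ Ax] : (\bigcup_i A i) x by rewrite -AT.
  have [j _ By] : (\bigcup_j B j) y by rewrite -BT.
  (* Both families are nondecreasing, so the index i + j dominates i and j. *)
  exists (i + j)%N => //; split => /=.
    by move: x Ax; apply/subsetPset/ndA/leq_addr.
  by move: y By; apply/subsetPset/ndB/leq_addl.
have [mAn Afin] := mA n; have [mBn Bfin] := mB n.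
split; first exact: measurableX.
by rewrite product_measure1E// lte_mul_pinfty// ge0_fin_numE.
Qed.

(** Bundled with its sigma-finiteness, the product can serve as the reference
    measure of a Radon-Nikodym derivative, as the density of a pair requires. *)
Definition product_sigma_finite :
    {sigma_finite_measure set (T1 * T2)%type -> \bar R} :=
  HB.pack (m1 \x m2)
    (Measure_isSigmaFinite.Build _ _ _ (m1 \x m2) sigma_finite_product).

(** The triangle inequality bounds the L1 norm of the partial integral by the
    iterated integral of |f|, finite by Tonelli. *)
Lemma integrable_fubini_G (f : T1 * T2 -> \bar R) :
  (m1 \x m2).-integrable [set: T1 * T2] f ->
  m2.-integrable [set: T2] (fubini_G m1 f).
Proof.
move=> fi; have mf := measurable_int _ fi.
apply/integrableP; split; first exact: measurable_fubini_G fi.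
apply: le_lt_trans ((integrable21ltyP m1 m2 mf).1 fi).
apply: ge0_le_integral => //.
- exact/measurableT_comp/(measurable_fubini_G fi).
- apply: (measurable_fun_fubini_tonelli_G (abse \o f)) => [|t].
    exact: measurableT_comp.
  exact: abse_ge0.
- move=> y _; apply: le_abse_integral => //.
  exact: measurable_fun_pair1.
Qed.

End product_sigma_finite.

(** * Expectations computed with a density *)

Section density.
Set Implicit Arguments.
Unset Strict Implicit.
Context (d d' : measure_display) (Omega : measurableType d)
  (T : measurableType d') (R : realType) (P : probability Omega R)
  (mu : {sigma_finite_measure set T -> \bar R}) (Y : Omega -> T) (f : T -> R).
Hypotheses (mY : measurable_fun [set: Omega] Y) (fY : has_density P mu Y f).

Let mf : measurable_fun [set: T] (fun t => (f t)%:E).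
Proof. by case: fY => mf _ _; exact/measurable_EFinP. Qed.

Let f0 t : 0 <= (f t)%:E.
Proof. by case: fY => _ f0 _; rewrite lee_fin. Qed.

Lemma integrable_density : mu.-integrable [set: T] (fun t => (f t)%:E).
Proof.
case: fY => _ _ fE; apply/integrableP; split => //.
rewrite (eq_integral (fun t => (f t)%:E)) => [|t _]; last first.
  by rewrite gee0_abs// f0.
by rewrite -fE// /pushforward preimage_setT probability_setT ltry.
Qed.

Let YY : {mfun Omega >-> T} :=
  HB.pack Y (isMeasurableFun.Build _ _ _ _ Y mY).

Let nu := distribution P YY.

Let nu_mu : nu `<< mu.
Proof.
case: fY => _ _ fE; apply/null_content_dominatesP => A mA A0.
rewrite [LHS]fE//; apply: null_set_integral => //.
exact: measurable_funTS.
Qed.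

(* Densities are almost everywhere unique, so that the change of variables
   known for the Radon-Nikodym derivative applies to f. *)
Let RN_density : ae_eq mu [set: T]
  (Radon_Nikodym (charge_of_finite_measure nu) mu) (fun t => (f t)%:E).
Proof.
case: fY => _ _ fE; apply: integral_ae_eq => //.
  exact: Radon_Nikodym_integrable.
move=> A _ mA.
by rewrite -Radon_Nikodym_integral// -fE.
Qed.

Let change_of_variables (g : T -> \bar R) : nu.-integrable [set: T] g ->
  \int[mu]_t (g t * (f t)%:E) = \int[nu]_t g t.
Proof.
move=> ig; rewrite -(Radon_Nikodym_change_of_variables nu_mu)//.
have mg := measurable_int _ ig.
apply: ae_eq_integral => //.
- exact: emeasurable_funM.
- apply: emeasurable_funM => //; apply: measurable_int;
  exact: Radon_Nikodym_integrable.
- exact/ae_eqe_mul2l/ae_eq_sym/RN_density.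
Qed.

Variable g : T -> \bar R.
Hypotheses (mg : measurable_fun [set: T] g)
  (ig : P.-integrable [set: Omega] (g \o Y)).

Let nu_ig : nu.-integrable [set: T] g.
Proof. exact: integrable_pushforward. Qed.

(** The law of Y has the Radon-Nikodym derivative f with respect to mu. *)
Lemma integral_has_density :
  \int[mu]_t (g t * (f t)%:E) = \int[P]_w g (Y w).
Proof. by rewrite change_of_variables// integral_pushforward. Qed.

Lemma integrable_has_density :
  mu.-integrable [set: T] (fun t => g t * (f t)%:E).
Proof.
apply/integrableP; split; first exact: emeasurable_funM.
rewrite (eq_integral (fun t => `|g t| * (f t)%:E)); last first.
  by move=> t _; rewrite abseM (gee0_abs (f0 t)).
rewrite (change_of_variables (integrable_abse nu_ig)).
by case/integrableP : nu_ig.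
Qed.

End density.

(** * The larger of two random variables *)

Definition snd_if_le {R : realType} (y z : R) : R :=
  if (y <= z)%R then z else 0%R.

Lemma integrable_snd_if_le {d : measure_display} {Omega : measurableType d}
  {R : realType} {P : probability Omega R} (Y Z : {RV P >-> R}) :
  P.-integrable [set: Omega] (EFin \o Z) ->
  P.-integrable [set: Omega] (fun w => (snd_if_le (Y w) (Z w))%:E).
Proof.
move=> iZ; apply: le_integrable iZ => //.
  by apply/measurable_EFinP/measurable_fun_ifT => //; exact: measurable_fun_ler.
by move=> w _ /=; rewrite /snd_if_le; case: ifP => // _; rewrite normr0 lee_fin.
Qed.

(** Both indicators are 1 on the event Y = Z, where the pointwise identity fails
    unless the common value is 0; hence the hypothesis that it is null. *)
Lemma expectation_dist (d : measure_display) (Omega : measurableType d)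
  (R : realType) (P : probability Omega R) (Y Z : {RV P >-> R}) :
  P.-integrable [set: Omega] (EFin \o Y) ->
  P.-integrable [set: Omega] (EFin \o Z) ->
  P [set w | Y w = Z w] = 0 ->
  'E_P[fun w => `|Y w - Z w|%R] =
  2%:E * \int[P]_w (snd_if_le (Z w) (Y w))%:E +
  2%:E * \int[P]_w (snd_if_le (Y w) (Z w))%:E - 'E_P[Y] - 'E_P[Z].
Proof.
move=> iY iZ YZ0; rewrite unlock.
have iYZ := integrable_snd_if_le Y iZ.
have iZY := integrable_snd_if_le Z iY.
have iS : P.-integrable [set: Omega] (fun w =>
    2%:E * (snd_if_le (Z w) (Y w))%:E + 2%:E * (snd_if_le (Y w) (Z w))%:E).
  by apply: integrableD => //; exact: integrableZl.
have iSY := integrableB measurableT iS iY.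
rewrite -!integralZl// -integralD//; try exact: integrableZl.
rewrite -!integralB//.
apply: ae_eq_integral => //.
- apply/measurable_EFinP/measurableT_comp => //.
  exact: measurable_funB.
- exact: measurable_int (integrableB measurableT iSY iZ).
exists [set w | Y w = Z w]; split => //.
  exact: measurable_set_eq.
move=> w /=; apply: contra_notP => /eqP YZ _.
rewrite /snd_if_le -!(EFinM, EFinD, EFinN); congr EFin.
case: (ltgtP (Y w) (Z w)) YZ => // lt _.
- by rewrite ltr0_norm ?subr_lt0// mulr0 add0r; lra.
- by rewrite gtr0_norm ?subr_gt0// mulr0 addr0; lra.
Qed.

(** * Pairs with a joint density *)

Section pair_density.
Set Implicit Arguments.
Unset Strict Implicit.
Context (d : measure_display) (Omega : measurableType d) (R : realType)
  (P : probability Omega R) (Y Z : {RV P >-> R}).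
Context (fYZ : measurableTypeR R * measurableTypeR R -> R) (fZ p : R -> R).
Hypotheses (hYZ : has_pair_density Y Z fYZ) (hZ : has_marginal_density Z fZ)
  (hp : is_diag_cond_cdf fYZ fZ p).

Local Notation leb := (@lebesgue_measure R).

Let mYZ : measurable_fun [set: Omega]
  (fun w => (Y w, Z w) : measurableTypeR R * measurableTypeR R).
Proof.
apply: measurable_fun_pair.
- exact: (measurable_funPT Y).
- exact: (measurable_funPT Z).
Qed.

Let mfYZ : measurable_fun [set: measurableTypeR R * measurableTypeR R]
  (fun t => (fYZ t)%:E).
Proof. by case: hYZ => mf _ _; apply/measurable_EFinP; exact: mf. Qed.

Let fYZ0 t : 0 <= (fYZ t)%:E.
Proof. by case: hYZ => _ f0 _; rewrite lee_fin. Qed.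

(** Both functions have the integral P(Z in E) over each Borel set E, the second
    by Tonelli on the strip with base E. *)
Lemma ae_marginal_density : ae_eq leb [set: measurableTypeR R]
  (fun z => (fZ z)%:E) (fun z => \int[leb]_u (fYZ (u, z))%:E).
Proof.
apply: integral_ae_eq => //.
- exact: (integrable_density hZ).
- exact: (measurable_fun_fubini_tonelli_G _ mfYZ fYZ0).
move=> E _ mE; case: hZ => _ _ <- //; case: hYZ => _ _ hE.
have mTE : measurable ([set: measurableTypeR R] `*` E) by exact: measurableX.
transitivity (pushforward P
    (fun w => (Y w, Z w) : measurableTypeR R * measurableTypeR R) (setT `*` E)).
  by congr (P _); apply/seteqP; split => w //= [].
rewrite hE// [LHS]integral_mkcond fubini_tonelli2; last 2 first.
- exact/(measurable_restrictT _ mTE)/measurable_funTS.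
- by move=> t; rewrite patchE; case: ifP.
rewrite [RHS]integral_mkcond; apply: eq_integral => z _.
rewrite /fubini_G patchE; case: ifPn => zE.
  apply: eq_integral => u _; rewrite patchE ifT// inE; split => //=.
  by rewrite inE in zE.
apply: integral0_eq => u _; rewrite patchE ifF//.
apply/negbTE; by apply: contra zE; rewrite !inE => -[].
Qed.

(** The diagonal is Lebesgue-null: each of its sections is a single point. *)
Lemma prob_eq_pair_density : P [set w | Y w = Z w] = 0.
Proof.
pose D := [set t : measurableTypeR R * measurableTypeR R | t.1 = t.2].
have mD : measurable D.
  by apply: measurable_set_eq; [exact: measurable_fst|exact: measurable_snd].
case: hYZ => _ _ /(_ _ mD) hD; rewrite [LHS]hD.
apply: null_set_integral => //; first exact: measurable_funTS.
rewrite /= /product_measure1; apply: integral0_eq => x _ /=.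
rewrite (_ : xsection D x = [set x]) ?lebesgue_measure_set1//.
by apply/seteqP; split => y; rewrite /xsection /D /= inE /=.
Qed.

Let fZ_eq0 z : ~~ (0 < fZ z)%R -> fZ z = 0%R.
Proof.
by case: hZ => _ f0 _; rewrite -leNgt => ?; apply/eqP; rewrite eq_le f0 andbT.
Qed.

(** Where fZ z > 0 the division by fZ z in the conditional distribution function
    cancels, provided that the integral is finite; it is bounded by the full
    section integral, which is fZ z for almost every z. *)
Lemma ae_mul_diag_cond_cdf : ae_eq leb [set: measurableTypeR R]
  (fun z => (fZ z * p z)%:E)
  (fun z => \int[leb]_(u in `]-oo, z]) (fYZ (u, z))%:E).
Proof.
apply: filterS ae_marginal_density => z /= /(_ I) fZz _.
have mz : measurable_fun [set: measurableTypeR R] (fun u => (fYZ (u, z))%:E).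
  exact: (measurable_fun_pair1 z mfYZ).
have i0 : 0 <= \int[leb]_(u in `]-oo, z]) (fYZ (u, z))%:E.
  exact: integral_ge0.
have ile : \int[leb]_(u in `]-oo, z]) (fYZ (u, z))%:E <= (fZ z)%:E.
  by rewrite fZz; apply: ge0_subset_integral.
move: (hp z); case: ifPn => [fz0 ->|fz0 _].
  rewrite /cond_cdf /Rintegral mulrCA divff ?gt_eqF// mulr1 fineK//.
  by rewrite ge0_fin_numE// (le_lt_trans ile)// ltry.
(* Here p z is arbitrary, but the integral is at most fZ z = 0. *)
rewrite (fZ_eq0 fz0) mul0r; apply/esym/eqP.
rewrite eq_le i0 andbT (le_trans ile)//.
by rewrite lee_fin leNgt.
Qed.

Let mle : measurable_fun [set: measurableTypeR R * measurableTypeR R]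
  (fun t => (t.1 <= t.2)%R).
Proof.
by apply: measurable_fun_ler; [exact: measurable_fst|exact: measurable_snd].
Qed.

Let measurable_lower_integral : measurable_fun [set: measurableTypeR R]
  (fun z => \int[leb]_(u in `]-oo, z]) (fYZ (u, z))%:E).
Proof.
pose F (t : measurableTypeR R * measurableTypeR R) :=
  if (t.1 <= t.2)%R then (fYZ t)%:E else 0.
have -> : (fun z => \int[leb]_(u in `]-oo, z]) (fYZ (u, z))%:E) =
    fubini_G leb F.
  apply/funext => z; rewrite integral_mkcond; apply: eq_integral => u _.
  by rewrite patchE /F mem_setE in_itv.
apply: measurable_fun_fubini_tonelli_G => [|t]; first exact: measurable_fun_ifT.
by rewrite /F; case: ifP.
Qed.

(* On the zeros of fZ, p may be a non-measurable function; the product with fZ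
   is measurable because it has an explicit formula that avoids p. *)
Let measurable_mul_diag_cond_cdf :
  measurable_fun [set: measurableTypeR R] (fun z => (fZ z * p z)%R).
Proof.
have -> : (fun z => (fZ z * p z)%R) = (fun z => if (0 < fZ z)%R
    then fine (\int[leb]_(u in `]-oo, z]) (fYZ (u, z))%:E) else 0%R).
  apply/funext => z; move: (hp z); case: ifPn => [fz0 ->|fz0 _].
    by rewrite /cond_cdf /Rintegral mulrCA divff ?gt_eqF// mulr1.
  by rewrite (fZ_eq0 fz0) mul0r.
have mfZ : measurable_fun [set: measurableTypeR R] fZ by case: hZ.
apply: measurable_fun_ifT => //; first exact: measurable_fun_ltr.
exact: (measurableT_comp (fine_measurable measurableT)).
Qed.

Hypotheses (iZ : P.-integrable [set: Omega] (EFin \o Z))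
  (YZ_gt0 : 0 < prob_le P Y Z).

Let g (t : measurableTypeR R * measurableTypeR R) :=
  (snd_if_le t.1 t.2)%:E.

Let mg : measurable_fun [set: measurableTypeR R * measurableTypeR R] g.
Proof.
apply/measurable_EFinP/measurable_fun_ifT => //; exact: measurable_snd.
Qed.

(* The same density statement over the bundled product measure, the form that
   the change of variables expects. *)
Let hYZ' : has_density P (product_sigma_finite leb leb)
  (fun w => (Y w, Z w) : measurableTypeR R * measurableTypeR R) fYZ.
Proof. exact: hYZ. Qed.

Let igf : (leb \x leb).-integrable
  [set: measurableTypeR R * measurableTypeR R] (fun t => g t * (fYZ t)%:E).
Proof.
exact: (integrable_has_density mYZ hYZ' mg (integrable_snd_if_le Y iZ)).
Qed.

(* For fixed z the factor z leaves the integral over u. *)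
Let ae_section : ae_eq leb [set: measurableTypeR R]
  (fubini_G leb (fun t => g t * (fYZ t)%:E)) (fun z => (z * (fZ z * p z))%:E).
Proof.
apply: filterS2 ae_marginal_density ae_mul_diag_cond_cdf => z.
move=> /(_ I) fZz /(_ I) fpz _; rewrite EFinM [X in _ * X]fpz /fubini_G.
have iz : leb.-integrable [set: measurableTypeR R] (fun u => (fYZ (u, z))%:E).
  apply/integrableP; split; first exact: (measurable_fun_pair1 z mfYZ).
  under eq_integral do rewrite gee0_abs//.
  by rewrite -fZz ltry.
rewrite -integralZl//; last exact: integrableS iz.
rewrite [RHS]integral_mkcond; apply: eq_integral => u _.
rewrite /g /snd_if_le patchE mem_setE in_itv /=; case: ifP => // _.
by rewrite mul0e.
Qed.

(** Multiplying by P(Y <= Z) removes the normalisation of the density; what is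
    left is an iterated integral of z 1{u <= z} f(u, z), to which Fubini
    applies since Z is integrable. *)
Lemma density_mean_hdens :
  prob_le P Y Z * density_mean (hdens fZ p (fine (prob_le P Y Z))) =
  \int[P]_w (snd_if_le (Y w) (Z w))%:E.
Proof.
have mle_w : measurable [set w | (Y w <= Z w)%R] by exact: measurable_set_le.
have : prob_le P Y Z \is a fin_num by exact: fin_num_measure.
move: YZ_gt0; rewrite /density_mean; case: (prob_le P Y Z) => // r.
rewrite lte_fin => r0 _ /=.
(* Replacing the integrand by a section integral makes its integrability
   available from that on the plane. *)
rewrite (ae_eq_integral
  (fun z => r^-1%:E * fubini_G leb (fun t => g t * (fYZ t)%:E) z)); first last.
- apply: filterS ae_section => z /(_ I) /= -> _.
  by rewrite /hdens -EFinM; congr EFin; rewrite mulrA [RHS]mulrC mulrA.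
- by apply: measurable_funeM; exact: (measurable_fubini_G igf).
- apply/measurable_EFinP/measurable_funM => //.
  rewrite /hdens; apply: measurable_funM; last exact: measurable_cst.
  exact: measurable_mul_diag_cond_cdf.
- exact: measurableT.
rewrite integralZl//; last exact: integrable_fubini_G igf.
rewrite integral21_prod_meas1// muleA -EFinM divff ?gt_eqF// mul1e.
exact: (integral_has_density mYZ hYZ' mg (integrable_snd_if_le Y iZ)).
Qed.

End pair_density.

(** * The Gini mean difference *)

Theorem theorem2 (d : measure_display) (Omega : measurableType d)
  (R : realType) (P : probability Omega R)
  (n : nat) (hn : (2 <= n)%N)
  (X : 'I_n -> {RV P >-> R})
  (fX : n.-tuple (measurableTypeR R) -> R)
  (hfX : has_joint_density X fX)
  (f1 : 'I_n -> R -> R)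
  (hf1 : forall j, has_marginal_density (X j) (f1 j))
  (f2 : 'I_n -> 'I_n -> R * R -> R)
  (hf2 : forall i j, i != j -> has_pair_density (X i) (X j) (f2 i j))
  (pij : 'I_n -> 'I_n -> R -> R)
  (hpi : forall i j, i != j -> is_diag_cond_cdf (f2 i j) (f1 j) (pij i j))
  (hX : forall i, P.-integrable [set: Omega] (EFin \o X i))
  (hR : forall i j, i != j -> 0 < prob_le P (X i) (X j)) :
  let Rij i j := prob_le P (X i) (X j) in
  let h i j := hdens (f1 j) (pij i j) (fine (Rij i j)) in
  let muH i j := density_mean (h i j) in
  let mu i := 'E_P[X i] in
  gini_mean_difference X =
  ('C(n, 2)%:R^-1)%:E *
  \sum_(i < n) \sum_(j < n | (i < j)%N)
    (2%:E * Rij j i * muH j i + 2%:E * Rij i j * muH i j - mu i - mu j).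
Proof.
rewrite /gini_mean_difference /=; congr (_ * _).
apply: eq_bigr => i _; apply: eq_bigr => j ltij.
have nij : i != j by apply: contraTneq ltij => ->; rewrite ltnn.
have nji : j != i by rewrite eq_sym.
rewrite -!muleA.
rewrite (density_mean_hdens (hf2 _ _ nij) (hf1 j) (hpi _ _ nij) (hX j))//;
  last exact: hR.
rewrite (density_mean_hdens (hf2 _ _ nji) (hf1 i) (hpi _ _ nji) (hX i))//;
  last exact: hR.
apply: expectation_dist => //; exact: prob_eq_pair_density (hf2 _ _ nij).
Qed.
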